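(* Let $k\ge 1$ and $n\ge 1$ be integers. Let $T$ be the complete $k$-ary tree with $n$ levels: a root at level $1$, and for each $j<n$ every vertex at level $j$ has exactly $k$ children at level $j+1$ (so level $j$ has $k^{j-1}$ vertices). Form the tree $T'$ by adding a new vertex $0$ adjacent only to the root. Let $L$ be the vertex Laplacian of $T'$, let $L_0$ be $L$ with the row and column of vertex $0$ deleted, let $\mathcal{C}=\{\lambda : L_0\lambda\ge 0\}$ in $\mathbb{R}^{V(T)}$, and set $\sigma_{\mathcal{C}}(q)=\sum_{\lambda\in\mathcal{C}\cap\mathbb{Z}^{V(T)}} q^{\sum_v\lambda_v}$. Then \[\sigma_{\mathcal{C}}(q)=\frac{1}{\prod_{j=1}^{n}\left(1-q^{\,j[n-j+1]_k+\sum_{i=1}^{j-1}(j-i)k^{n-(j-i)}}\right)^{k^{j-1}}} =\frac{1}{\prod_{j=1}^{n}\left(1-q^{\,j[n-j+1]_k+k^{n-j}\left(j([j]_k-1)-k\frac{d}{dk}([j]_k-1)\right)}\right)^{k^{j-1}}}.\]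
   Context: For a positive integer $m$, $[m]_k=1+k+k^2+\cdots+k^{m-1}$ (viewed as a polynomial in $k$ when differentiating). The vertex Laplacian of a simple graph is $L=D-A$ with $D$ the diagonal degree matrix and $A$ the $0/1$ adjacency matrix. The level of a vertex of $T$ is its distance to vertex $0$ in $T'$. *)

(* Defs.v *)
From HB Require Import structures.
From mathcomp Require Import all_boot all_order all_algebra.
From mathcomp Require Import finmap.
From mathcomp Require Import all_classical all_reals.

Set Implicit Arguments.
Unset Strict Implicit.
Unset Printing Implicit Defensive.

Import Order.TTheory GRing.Theory Num.Theory.

Local Open Scope ring_scope.

Section PowerSeries.
Variable R : comNzRingType.

(* A wrapper around [nat -> R], which keeps the Cauchy product apart from the
   pointwise product that [nat -> R] already carries. *)
Record series : Type := Series { coefs : nat -> R }.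

Lemma coefs_inj : injective coefs.
Proof. by case=> f [g] /= ->. Qed.

HB.instance Definition _ := gen_eqMixin series.
HB.instance Definition _ := gen_choiceMixin series.

Lemma seriesP (f g : series) : (forall n, coefs f n = coefs g n) -> f = g.
Proof. by move=> fg; apply/coefs_inj/funext. Qed.

Definition series_zero := Series (fun=> 0).
Definition series_opp (f : series) := Series (fun n => - coefs f n).
Definition series_add (f g : series) := Series (fun n => coefs f n + coefs g n).
Definition series_one := Series (fun n => (n == 0%N)%:R).
Definition series_mul (f g : series) :=
  Series (fun n => \sum_(i < n.+1) coefs f i * coefs g (n - i)).

Fact series_addA : associative series_add.
Proof. by move=> f g h; apply: seriesP => n /=; rewrite addrA. Qed.
Fact series_addC : commutative series_add.
Proof. by move=> f g; apply: seriesP => n /=; rewrite addrC. Qed.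
Fact series_add0 : left_id series_zero series_add.
Proof. by move=> f; apply: seriesP => n /=; rewrite add0r. Qed.
Fact series_addN : left_inverse series_zero series_opp series_add.
Proof. by move=> f; apply: seriesP => n /=; rewrite addNr. Qed.

HB.instance Definition _ := GRing.isZmodule.Build series
  series_addA series_addC series_add0 series_addN.

Let trunc n (f : series) : {poly R} := \poly_(i < n.+1) coefs f i.

Let coef_trunc n f i : (i <= n)%N -> (trunc n f)`_i = coefs f i.
Proof. by move=> le_in; rewrite coef_poly ltnS le_in. Qed.

Let coef_series_mul n f g i : (i <= n)%N ->
  coefs (series_mul f g) i = (trunc n f * trunc n g)`_i.
Proof.
move=> le_in; rewrite coefM; apply: eq_bigr => j _.
by rewrite !coef_trunc // (leq_trans _ le_in) ?leq_subr // leq_ord.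
Qed.

Fact series_mulC : commutative series_mul.
Proof.
by move=> f g; apply: seriesP => n; rewrite !(@coef_series_mul n) // mulrC.
Qed.

Fact series_mulA : associative series_mul.
Proof.
move=> f g h; apply: seriesP => n.
have -> : coefs (series_mul f (series_mul g h)) n =
    (trunc n f * (trunc n g * trunc n h))`_n.
  rewrite coefM; apply: eq_bigr => i _; have le_in := leq_ord i.
  by rewrite coef_trunc // (@coef_series_mul n) ?leq_subr.
rewrite mulrA coefM; apply: eq_bigr => i _; have le_in := leq_ord i.
by rewrite (@coef_series_mul n) // coef_trunc ?leq_subr.
Qed.

Fact series_mul1 : left_id series_one series_mul.
Proof.
move=> f; apply: seriesP => n /=.
rewrite big_ord_recl /= subn0 mul1r big1 ?addr0 // => i _.
by rewrite mul0r.
Qed.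

Fact series_mulDl : left_distributive series_mul series_add.
Proof.
move=> f g h; apply: seriesP => n /=; rewrite -big_split.
by apply: eq_bigr => i _; rewrite mulrDl.
Qed.

Fact series_1neq0 : series_one != series_zero.
Proof.
apply/eqP => /(congr1 (fun f => coefs f 0%N)) /= /eqP.
by rewrite oner_eq0.
Qed.

HB.instance Definition _ := GRing.Zmodule_isComNzRing.Build series
  series_mulA series_mulC series_mul1 series_mulDl series_1neq0.

Definition series_unit : {pred series} := fun f => `[< exists g, g * f = 1 >].
Definition series_inv (f : series) : series :=
  xget f [set g | g * f = 1]%classic.

Fact series_mulV : {in series_unit, left_inverse 1 series_inv *%R}.
Proof.
move=> f /asboolP[g gf1].
by rewrite /series_inv; case: xgetP => [h _ //|/(_ g)].
Qed.

Fact series_unitPl (f g : series) : g * f = 1 -> series_unit f.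
Proof. by move=> gf1; apply/asboolP; exists g. Qed.

Fact series_inv_out : {in [predC series_unit], series_inv =1 id}.
Proof.
move=> f /asboolP nf; rewrite /series_inv; case: xgetP => // g _ gf1.
by case: nf; exists g.
Qed.

HB.instance Definition _ := GRing.ComNzRing_hasMulInverse.Build series
  series_mulV series_unitPl series_inv_out.

Definition series_q : series := Series (fun n => (n == 1%N)%:R).

End PowerSeries.

Arguments series_q {R}.

Definition laplacian (R : pzRingType) (V : finType) (e : rel V) : 'M[R]_#|V| :=
  diag_mx (\row_i #|[pred y | e (enum_val i) y]|%:R)
  - \matrix_(i, j) (e (enum_val i) (enum_val j))%:R.

Definition delete_vertex (R : Type) (V : finType) (x : V) (M : 'M[R]_#|V|) :
  'M[R]_(#|V|.-1) := row' (enum_rank x) (col' (enum_rank x) M).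

(* The complete k-ary tree with n levels (n >= 1): a vertex at level j is the
   word of length j - 1 in 'I_k recording the path from the root (the empty
   word), and the children of w are the words [rcons w a]. *)
Definition kary_vertex (k n : nat) : finType := {bseq n.-1 of 'I_k}.

Definition kary_root (k n : nat) : kary_vertex k n := [bseq].

Definition kary_child (k n : nat) : rel (kary_vertex k n) :=
  fun v w => [exists a : 'I_k, (w : seq 'I_k) == rcons v a].

Definition kary_adj (k n : nat) : rel (kary_vertex k n) :=
  fun v w => kary_child v w || kary_child w v.

(* The graph obtained from (V, e) by adding a vertex, [None], adjacent only
   to r. *)
Definition add_leaf (V : finType) (e : rel V) (r : V) : rel (option V) :=
  fun x y => match x, y with
  | Some v, Some w => e v w
  | Some v, None | None, Some v => v == r
  | None, None => false
  end.

Definition kary_L0 (R : pzRingType) (k n : nat) :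
    'M[R]_(#|{: option (kary_vertex k n)}|.-1) :=
  delete_vertex None
    (laplacian R (add_leaf (@kary_adj k n) (kary_root k n))).

Local Open Scope classical_set_scope.

Definition cone (R : realType) (m N : nat) (M : 'M[R]_(m, N)) : set 'cV[R]_N :=
  [set x | forall i, 0 <= (M *m x) i 0].

Definition int_points_of_sum (R : realType) (N : nat) (C : set 'cV[R]_N)
    (s : int) : set 'cV[R]_N :=
  [set x | [/\ C x, x \is a mxOver Num.int & \sum_v x v 0 = s%:~R]].

(* The sum of q ^ (\sum_v x_v) over the integer points x of C is a formal power
   series: only finitely many terms contribute to each power of q, and no
   negative power of q occurs. *)
Definition has_int_point_series (R : realType) (N : nat) (C : set 'cV[R]_N) :=
  forall s : int, finite_set (int_points_of_sum C s) /\
    (s < 0 -> int_points_of_sum C s = set0).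

(* Meaningful under [has_int_point_series C]. *)
Definition int_point_series (R : realType) (N : nat) (C : set 'cV[R]_N) :
    series int :=
  Series (fun s : nat => (#|` fset_set (int_points_of_sum C s%:Z)|)%:R).

(* [m]_k; the polynomial in k is obtained for k = 'X. *)
Definition bracket (R : nzSemiRingType) (m : nat) (k : R) : R :=
  \sum_(0 <= i < m) k ^+ i.

Definition exponent1 (k n j : nat) : nat :=
  (j * bracket (n - j + 1) k
   + \sum_(1 <= i < j) (j - i) * k ^ (n - (j - i)))%N.

(* The derivative with respect to k is that of the polynomial [j]_k - 1. *)
Definition exponent2 (k n j : nat) : int :=
  let p : {poly int} := bracket j 'X - 1 in
  j%:Z * bracket (n - j + 1) k%:Z
  + k%:Z ^+ (n - j) * (j%:Z * p.[k%:Z] - k%:Z * p^`().[k%:Z]).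

(* Main.v *)
(* Let B be the edge-vertex incidence matrix of T' with the column of vertex 0
   deleted, an edge being indexed by its lower endpoint; then L_0 = B^T B.  The
   inverse of B is the ancestor (prefix) matrix Q, so L_0 is invertible over
   the integers and the (u, v) entry of its inverse Q Q^T is the number of
   common ancestors of u and v.  Hence the cone is unimodular, generated by the
   columns of this inverse, and its series is the product over v of
   1 / (1 - q^(c_v)), where c_v is the sum of column v.  For v at level j,
   summing the sizes of the subtrees rooted at the ancestors of v gives
   c_v = [n]_k + [n-1]_k + ... + [n-j+1]_k. *)
Require Import Defs.
From mathcomp Require Import all_boot all_order all_algebra.
From mathcomp Require Import finmap ring zify.
From mathcomp Require Import all_classical all_reals.

Set Implicit Arguments.
Unset Strict Implicit.
Unset Printing Implicit Defensive.

Import Order.TTheory GRing.Theory Num.Theory.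

Local Open Scope ring_scope.

(** * Powers of [series_q] and inverses of products of factors [1 - q^c] *)

Section SeriesTheory.
Variable R : comNzRingType.
Implicit Types f g : series R.

Lemma coefs_mulqXn f m i :
  coefs (f * series_q ^+ m) i = if (i < m)%N then 0 else coefs f (i - m).
Proof.
elim: m i => [|m IH] i; first by rewrite mulr1 subn0.
rewrite exprSr mulrA.
case: i => [|i]; first by rewrite /= big_ord1 /= mulr0.
transitivity (coefs (f * series_q ^+ m) i); last by rewrite IH ltnS subSS.
rewrite /= big_ord_recr /= subnn mulr0 addr0 big_ord_recr /=.
rewrite subSn // subnn mulr1.
rewrite big1 ?add0r // => j _; rewrite subSn ?(ltnW (ltn_ord _)) //= eqSS.
by rewrite subn_eq0 leqNgt ltn_ord mulr0.
Qed.

Lemma coefs_sum (I : Type) (r : seq I) (P : pred I) (F : I -> series R) i :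
  coefs (\sum_(j <- r | P j) F j) i = \sum_(j <- r | P j) coefs (F j) i.
Proof. exact: (big_morph (fun f => coefs f i)). Qed.

Lemma coefs_qXn m i : coefs (series_q ^+ m : series R) i = (i == m)%:R.
Proof.
rewrite -[_ ^+ m]mul1r coefs_mulqXn /=.
by case: (ltngtP i m) => [|lt_mi|->]; rewrite ?subnn // subn_eq0 leqNgt lt_mi.
Qed.

(** Multiplication by [q^c] shifts coefficients by [c], which preserves divisibility by [c], so
    everything cancels except the coefficient at 0. *)
Lemma geometric_seriesP c : (0 < c)%N ->
  Series (fun m => (c %| m)%:R) * (1 - series_q ^+ c) = 1 :> series R.
Proof.
move=> c_gt0; apply: seriesP => m.
rewrite mulrBr mulr1.
transitivity ((c %| m)%:R -
  coefs (Series (fun m => (c %| m)%:R) * series_q ^+ c) m : R) => //.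
rewrite coefs_mulqXn /=; case: ltnP => [lt_mc | le_cm].
  rewrite subr0; case: m lt_mc => [|m] lt_mc; first by rewrite dvdn0.
  by rewrite gtnNdvd.
rewrite dvdn_subl // subrr.
by case: m le_cm => // /(leq_trans c_gt0).
Qed.

Lemma prod_1subqXn_unit (I : Type) (r : seq I) (c : I -> nat) :
  (forall i, 0 < c i)%N ->
  \prod_(i <- r) (1 - series_q ^+ c i) \is a @GRing.unit (series R).
Proof.
move=> c_gt0; apply: rpred_prod => i _.
by apply: series_unitPl; apply: geometric_seriesP.
Qed.

Lemma prod_1subqXn_mod (I : Type) (r : seq I) (c : I -> nat) s :
  (forall i, s < c i)%N ->
  exists h : series R,
    \prod_(i <- r) (1 - series_q ^+ c i) = 1 + h * series_q ^+ s.+1.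
Proof.
move=> c_gts; elim: r => [|i r [h IH]].
  by exists 0; rewrite big_nil mul0r addr0.
rewrite big_cons IH -(subnK (c_gts i)) exprD.
set q := _ ^+ s.+1; set p := _ ^+ _.
by exists (h - p - p * q * h); ring.
Qed.

(** Since every [c i] is positive, a solution has all [f i] at most [s]; values in ['I_s.+1]
    therefore lose none. *)
Lemma coefs_inv_prod_1subqXn (I : finType) (c : I -> nat) s :
  (forall i, 0 < c i)%N ->
  coefs (\prod_i (1 - series_q ^+ c i) : series R)^-1 s =
  #|[set f : {ffun I -> 'I_s.+1} | (\sum_i c i * f i)%N == s]|%:R.
Proof.
move=> c_gt0; set P := \prod_i _; set D := [set f | _].
have uP : P \is a GRing.unit by exact: prod_1subqXn_unit.
(* Modulo q^(s+1), the inverse is a product T of truncated geometric series. *)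
pose T : series R := \prod_i \sum_(j < s.+1) (series_q ^+ c i) ^+ j.
have PT : P * T = \prod_i (1 - series_q ^+ (c i * s.+1)).
  rewrite -big_split; apply: eq_bigr => i _ /=.
  by rewrite exprM -opprB mulNr -subrX1 opprB.
(* As [c i >= 1], each exponent [c i * s.+1] exceeds [s], so [P * T] is 1 modulo [q^(s+1)]. *)
have [h hE] := @prod_1subqXn_mod I (index_enum I) (fun i => c i * s.+1)%N s
  (fun i => leq_pmull _ (c_gt0 i)).
have -> : P^-1 = T - (P^-1 * h) * series_q ^+ s.+1.
  by apply: (mulrI uP); rewrite divrr // mulrBr PT hE !mulrA divrr //
    mul1r addrK.
transitivity (coefs T s - coefs (P^-1 * h * series_q ^+ s.+1) s) => //.
rewrite coefs_mulqXn ltnSn subr0 /T bigA_distr_bigA coefs_sum.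
rewrite -sum1_card natr_sum [RHS]big_mkcond; apply: eq_bigr => f _.
under eq_bigr do rewrite -exprM.
rewrite prodrXr coefs_qXn eq_sym inE.
by case: (_ == _).
Qed.

End SeriesTheory.

(** * Lattice points of a unimodular cone *)

Section UnimodularCone.
Variables (R : realType) (N : nat) (M : 'M[R]_N) (g : 'M[nat]_N).
(** The columns of [G] generate the cone; [g] has entries in [nat] so that its column sums can serve
    as exponents. *)
Let G : 'M[R]_N := map_mx (fun a : nat => a%:R) g.
Let c (j : 'I_N) := (\sum_i g i j)%N.
Hypothesis M_int : M \is a mxOver Num.int.
Hypothesis MG : M *m G = 1%:M.
Hypothesis c_gt0 : forall j, (0 < c j)%N.

Let ray_sum s (f : {ffun 'I_N -> 'I_s}) : 'cV[R]_N := G *m \col_i (f i)%:R.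

Lemma ray_sum_inj s : injective (@ray_sum s).
Proof.
move=> f1 f2 /(congr1 (mulmx M)); rewrite !mulmxA MG !mul1mx => f12.
apply/ffunP => i; apply/val_inj/eqP; rewrite -(eqr_nat R).
by move/colP/(_ i): f12; rewrite !mxE => ->.
Qed.

Lemma sum_mul_ray_matrix (y : 'cV[R]_N) :
  \sum_v (G *m y) v 0 = \sum_j (c j)%:R * y j 0.
Proof.
under eq_bigr do rewrite mxE.
rewrite exchange_big; apply: eq_bigr => j _ /=.
by rewrite natr_sum mulr_suml; apply: eq_bigr => i _; rewrite mxE.
Qed.

(** The coordinates are the entries of [M *m x]: nonnegative because [x] is in the cone, integral
    because [M] and [x] are. *)
Lemma int_point_coordinates (x : 'cV[R]_N) :
    cone M x -> x \is a mxOver Num.int ->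
  exists2 m : 'I_N -> nat, x = G *m \col_i (m i)%:R &
    \sum_v x v 0 = (\sum_j c j * m j)%N%:R.
Proof.
move=> Cx x_int.
have Mx_nat i : (M *m x) i 0 \is a Num.nat.
  by rewrite natrEint Cx andbT; have /mxOverP := mxOverM M_int x_int.
have xE : x = G *m \col_i (Num.trunc ((M *m x) i 0))%:R.
  rewrite -[LHS]mul1mx -(mulmx1C MG) -mulmxA; congr (_ *m _).
  by apply/colP => i; rewrite [RHS]mxE truncK.
exists (fun i => Num.trunc ((M *m x) i 0)); first by [].
rewrite {1}xE sum_mul_ray_matrix natr_sum; apply: eq_bigr => j _.
by rewrite natrM [X in _ * X]mxE.
Qed.

Lemma int_points_of_sum_nat (s : nat) :
  int_points_of_sum (cone M) s%:Z =
  (@ray_sum s.+1 @`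
     [set` [set f : {ffun 'I_N -> 'I_s.+1} | (\sum_j c j * f j)%N == s]%SET])%classic.
Proof.
apply/seteqP; split=> x.
  case=> Cx x_int; have [m -> ->] := int_point_coordinates Cx x_int.
  move/eqP; rewrite -pmulrn eqr_nat => /eqP sE.
  (* [m j <= c j * m j], which is one term of a sum equal to [s]. *)
  have m_les j : (m j < s.+1)%N.
    rewrite ltnS -sE (bigD1 j) //= (leq_trans _ (leq_addr _ _)) //.
    exact: leq_pmull.
  exists [ffun j => Ordinal (m_les j)] => /=.
    by rewrite inE -[X in _ == X]sE; apply/eqP/eq_bigr => j _; rewrite ffunE.
  by congr (_ *m _); apply/colP => j; rewrite !mxE ffunE.
case=> f /=; rewrite inE => /eqP fE <-; split.
- move=> i; rewrite /ray_sum mulmxA MG mul1mx mxE; exact: ler0n.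
- by apply: mxOverM; apply/mxOverP => i j; rewrite !mxE; exact: natr_int.
- rewrite sum_mul_ray_matrix -[in RHS]fE -pmulrn natr_sum.
  by apply: eq_bigr => j _; rewrite natrM !mxE.
Qed.

Lemma has_int_point_series_unimodular : has_int_point_series (cone M).
Proof.
have neg (s : int) : s < 0 -> (int_points_of_sum (cone M) s = set0)%classic.
  move=> s_lt0; apply/seteqP; split=> // x [Cx x_int].
  have [m _ ->] := int_point_coordinates Cx x_int.
  move=> /eqP; rewrite pmulrn eqr_int => /eqP sE.
  by move: s_lt0; rewrite -sE.
move=> s; split; last exact: neg.
case: s => s; last by rewrite neg.
by rewrite int_points_of_sum_nat; exact/finite_image/finite_finset.
Qed.

Lemma int_point_series_unimodular :
  int_point_series (cone M) = 1 / \prod_j (1 - series_q ^+ c j).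
Proof.
apply: seriesP => s; rewrite div1r coefs_inv_prod_1subqXn //=.
rewrite int_points_of_sum_nat fset_set_image; last exact: finite_finset.
rewrite card_imfset /=; last exact: ray_sum_inj.
set D := [set f | _]; congr (_%:R); rewrite cardE; apply/perm_size/uniq_perm.
- exact: fset_uniq.
- exact: enum_uniq.
move=> f; rewrite mem_enum in_fset_set; last exact: finite_finset.
by apply/idP/idP; rewrite inE.
Qed.

End UnimodularCone.

(** * Brackets and the two forms of the exponent *)

Lemma bracketS (R : nzSemiRingType) (m : nat) (x : R) :
  bracket m.+1 x = bracket m x + x ^+ m.
Proof. by rewrite /bracket big_nat_recr. Qed.

(** From [j] to [j + 1], the [j] old brackets each lose [k^(n-j)]. The new [i = 1] term restores
    this, the other terms are the old ones shifted, and the extra bracket [[n-j]_k] is the new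
    summand. *)
Lemma exponent1_sum (k n j : nat) : (1 <= j <= n)%N ->
  exponent1 k n j = (\sum_(0 <= m < j) bracket (n - m) k)%N.
Proof.
case: j => // j /andP[_]; rewrite /exponent1; elim: j => [|j IH] ltjn.
  by rewrite big_geq // big_nat1 mul1n addn0 subn0 subn1 addn1 prednK.
rewrite [RHS]big_nat_recr //= -IH ?(ltnW ltjn) //.
rewrite big_ltn // big_add1 /= subSS subn0.
have -> : (n - j.+1 + 1 = (n - j.+2 + 1).+1)%N by lia.
rewrite bracketS natrXE natrDE.
have -> : (n - j.+1 = n - j.+2 + 1)%N by lia.
under eq_bigr do rewrite subSS.
lia.
Qed.

Lemma exponent1_gt0 (k n j : nat) : (0 < exponent1 k n j.+1)%N.
Proof.
have: (0 < bracket (n - j.+1).+1 k)%N.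
  by rewrite /bracket big_ltn // expr0 natrDE.
by rewrite /exponent1 addn1 addn_gt0 muln_gt0 => ->.
Qed.

(** The operator [k d/dk] multiplies [k^i] by [i], so the last factor is the sum of [(j-i) k^i] over
    [1 <= i < j]. *)
Lemma exponent2E (k n j : nat) : (1 <= j <= n)%N ->
  exponent2 k n j = (exponent1 k n j)%:Z.
Proof.
case: j => // j /andP[_ le_jn]; rewrite /exponent1 /exponent2.
have -> : bracket j.+1 'X - 1 = \sum_(1 <= i < j.+1) 'X^i :> {poly int}.
  by rewrite /bracket big_ltn // expr0 addrC addrA addNr add0r.
rewrite PoszD PoszM; congr (_ * _ + _).
  rewrite /bracket -[RHS]natz natr_sum; apply: eq_bigr => i _.
  by rewrite natrXE natrX natz.
rewrite horner_sum raddf_sum horner_sum !mulr_sumr -sumrB mulr_sumr.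
rewrite -[RHS]natz natr_sum; apply: eq_big_nat => i /andP[i_gt0 lt_ij].
rewrite /= hornerXn derivXn hornerMn hornerXn natrM natrX !natz.
have -> : (n - (j.+1 - i) = n - j.+1 + i)%N by lia.
rewrite -subzn ?(ltnW lt_ij) // exprD -[_ *+ i]mulr_natl natz.
by case: i i_gt0 {lt_ij} => // i _; rewrite exprS /=; ring.
Qed.

(** * Words as tree vertices: levels, ancestors and subtrees *)

Lemma big_kary_level (R : Type) (idx : R) (op : Monoid.com_law idx)
    (k n : nat) (F : nat -> R) : (1 <= n)%N ->
  \big[op/idx]_(v : kary_vertex k n) F (size v) =
  \big[op/idx]_(0 <= m < n) iter (k ^ m) (op (F m)) idx.
Proof.
case: n => // n' _; rewrite big_mkord.
(* A word of length at most [n'] is a length [m] with an [m]-tuple, and there are [k ^ m] such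
   tuples. *)
rewrite (reindex (@tagged_tuple_bseq n' 'I_k)) /=; last exact: onW_bij.
under eq_bigr do rewrite size_tuple.
rewrite -(@sig_big_dep _ _ _ 'I_n'.+1 (fun m => m.-tuple 'I_k : finType)
  xpredT (fun m => xpredT) (fun m _ => F m)) /=.
by apply: eq_bigr => m _; rewrite big_const card_tuple card_ord.
Qed.

Lemma prefix_rconsE (T : eqType) (s t : seq T) (x : T) :
  prefix s (rcons t x) = (s == rcons t x) || prefix s t.
Proof.
apply/idP/orP => [|[/eqP -> //|]]; last 2 first.
- exact: prefix_refl.
- by move/prefix_trans; apply; exact: prefix_rcons.
case/prefixP => r; case/lastP: r => [|r y]; first by rewrite cats0 => <-; left.
by rewrite -rcons_cat => /rcons_inj[-> _]; right; exact: prefix_prefix.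
Qed.

Section KaryTree.
Variables k n : nat.
Hypothesis n_gt0 : (1 <= n)%N.
Local Notation V := (kary_vertex k n).
Local Notation root := (kary_root k n).
Implicit Types u v w : V.

Lemma size_kary v : (size v < n)%N.
Proof. by have := size_bseq v; move: n_gt0; lia. Qed.

(** Truncation never lengthens a word, so the default of [insub_bseq] is never taken. *)
Definition kary_truncate m v : V := insub_bseq n.-1 (take m v).

Lemma kary_truncateE m v : kary_truncate m v = take m v :> seq _.
Proof.
rewrite /kary_truncate /insub_bseq insubdK //.
by apply: leq_trans (size_bseq v); rewrite size_take_min geq_minr.
Qed.

(* Junk value: [kary_parent root = root]. *)
Definition kary_parent v : V := kary_truncate (size v).-1 v.

Lemma kary_childE v w : kary_child v w = (w != root) && (v == kary_parent w).
Proof.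
rewrite -!val_eqE /= kary_truncateE.
apply/existsP/andP => [[a /eqP ->] | [w_neq0 /eqP ->]].
  by rewrite size_rcons -cats1 take_size_cat // eqxx; case: (val v).
case/lastP: (val w) w_neq0 => // s a _; exists a.
by rewrite size_rcons -{2}cats1 take_size_cat.
Qed.

Lemma prefix_kary_parent w v : v != root ->
  prefix w v = (w == v) || prefix w (kary_parent v).
Proof.
rewrite -!val_eqE /= kary_truncateE.
case/lastP: (val v) => // s a _.
by rewrite size_rcons -{3}cats1 take_size_cat // prefix_rconsE.
Qed.

Lemma kary_child_prefix v w : kary_child v w -> ~~ prefix w v.
Proof.
case/existsP=> a /eqP ->; apply/negP => /size_prefix.
by rewrite size_rcons ltnn.
Qed.

(** The ancestors of [v] are its truncations, exactly one for each length from 0 to [size v]. *)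
Lemma big_kary_prefix (R : Type) (idx : R) (op : Monoid.com_law idx)
    (F : nat -> R) v :
  \big[op/idx]_(w : V | prefix w v) F (size w) =
  \big[op/idx]_(0 <= m < (size v).+1) F m.
Proof.
rewrite big_mkord.
have sz (m : 'I_(size v).+1) : size (kary_truncate m v) = m.
  by rewrite kary_truncateE size_takel // -ltnS.
rewrite (reindex_onto (fun m : 'I_(size v).+1 => kary_truncate m v)
  (fun w => inord (size w))) => [|w].
  apply: eq_big => [m | m _]; last by rewrite sz.
  by rewrite sz inord_val eqxx kary_truncateE prefix_take.
move=> wv; have := wv; rewrite prefixE => /eqP wE.
by apply/val_inj; rewrite /= kary_truncateE inordK ?ltnS ?size_prefix.
Qed.

(** Appending words of length at most [n - size w - 1] to [w] identifies its subtree with a tree of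
    [n - size w] levels. *)
Lemma card_kary_descendants w :
  #|[pred u : V | prefix w u]| = bracket (n - size w) k.
Proof.
have lt_wn := size_kary w.
have szcat (x : {bseq (n - size w).-1 of 'I_k}) : (size (w ++ x) <= n.-1)%N.
  rewrite size_cat (leq_trans (leq_add (leqnn _) (size_bseq x))) //.
  by move: lt_wn; lia.
pose ext (x : {bseq (n - size w).-1 of 'I_k}) : V := Bseq (szcat x).
have ext_inj : injective ext.
  by move=> x y [/eqP]; rewrite eqseq_cat // eqxx /= => /eqP /val_inj.
transitivity #|codom ext|.
  apply: eq_card => u; rewrite inE.
  apply/idP/codomP => [/prefixP[s uE] | [x ->]]; last exact: prefix_prefix.
  have sz_s : (size s <= (n - size w).-1)%N.
    by rewrite -ltnS prednK ?subn_gt0 // ltn_subRL -size_cat -uE size_kary.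
  by exists (Bseq sz_s); apply/val_inj.
by rewrite card_codom // card_bseq card_ord /bracket big_mkord prednK
  ?subn_gt0.
Qed.

End KaryTree.

(** * The Laplacian reduced at an added leaf *)

Section AddLeaf.
Variables (V : finType) (e : rel V) (r : V).

(* The default [r] is never used, see [Some_old_vertex]. *)
Definition old_vertex (i : 'I_(#|{: option V}|.-1)) : V :=
  odflt r (enum_val (lift (enum_rank None) i)).

Lemma Some_old_vertex i :
  Some (old_vertex i) = enum_val (lift (enum_rank None) i).
Proof.
rewrite /old_vertex; case E: enum_val => [v|] //=.
have /eqP := congr1 enum_rank E.
by rewrite enum_valK eq_sym (negPf (neq_lift _ _)).
Qed.

Lemma old_vertex_inj : injective old_vertex.
Proof.
move=> i j ij; apply: (@lift_inj _ (enum_rank None)).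
by apply: enum_val_inj; rewrite -!Some_old_vertex ij.
Qed.

Lemma old_vertex_bij : bijective old_vertex.
Proof.
by apply: (inj_card_bij old_vertex_inj); rewrite card_ord card_option.
Qed.

Lemma card_add_leaf_neighbors v :
  #|[pred y | add_leaf e r (Some v) y]| = (#|[pred w | e v w]| + (v == r))%N.
Proof.
rewrite -!sum1_card big_mkcond [in RHS]big_mkcond /= (bigD1 None) //= inE /=.
rewrite addnC; congr (_ + _)%N.
rewrite (reindex_onto Some (odflt r)) /=; last by case.
by apply: eq_big => [w|w _]; rewrite ?inE ?eqxx.
Qed.

Lemma reduced_laplacian_add_leafE (R : pzRingType) i j :
  let u := old_vertex i in let v := old_vertex j in
  delete_vertex None (laplacian R (add_leaf e r)) i j =
  (#|[pred w | e u w]| + (u == r))%:R *+ (u == v) - (e u v)%:R.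
Proof.
move=> u v; rewrite !mxE -!Some_old_vertex card_add_leaf_neighbors.
by rewrite (inj_eq (@lift_inj _ _)) (inj_eq old_vertex_inj).
Qed.

End AddLeaf.

(** * Factorization and inverse of [L_0] *)

Definition common_ancestors (k n : nat) :
    'M[nat]_(#|{: option (kary_vertex k n)}|.-1) :=
  \matrix_(i, j) (\sum_(w : kary_vertex k n)
    prefix w (old_vertex (kary_root k n) i)
    * prefix w (old_vertex (kary_root k n) j))%N.

(** Double counting: each ancestor of the vertex contributes its number of descendants. The
    successor turns depth into level. *)
Lemma sum_common_ancestors (k n : nat) j : (1 <= n)%N ->
  (\sum_i common_ancestors k n i j =
   exponent1 k n (size (old_vertex (kary_root k n) j)).+1)%N.
Proof.
move=> n_gt0; set v := old_vertex _ j.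
rewrite exponent1_sum ?size_kary // -big_kary_prefix //.
under eq_bigr do rewrite mxE.
rewrite exchange_big [RHS]big_mkcond; apply: eq_bigr => w _ /=.
rewrite -big_distrl /= -/v; case: (prefix w v); last by rewrite muln0.
rewrite muln1 -card_kary_descendants // -[RHS]sum1_card [RHS]big_mkcond.
rewrite [RHS](reindex (old_vertex (kary_root k n))) /=; last first.
  exact/onW_bij/old_vertex_bij.
by apply: eq_bigr => i _; rewrite inE; case: prefix.
Qed.

Section KaryInverse.
Variables (R : realType) (k n : nat).
Local Notation V := (kary_vertex k n).
Local Notation root := (kary_root k n).
Local Notation vert := (@old_vertex V root).

(* Row [a] is the edge from [a] to its parent, which is vertex 0 for the root. *)
Let B : 'M[R]_(#|{: option V}|.-1) :=
  \matrix_(a, v) ((vert v == vert a)%:R - (kary_child (vert v) (vert a))%:R).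

Let Q : 'M[R]_(#|{: option V}|.-1) :=
  \matrix_(v, w) (prefix (vert w) (vert v))%:R.

(** The parent is unique, and the factor [a != root] cancels the junk value at the root. *)
Lemma sum_kary_child (F : V -> R) a :
  \sum_v (kary_child v a)%:R * F v = (a != root)%:R * F (kary_parent a).
Proof.
rewrite (bigD1 (kary_parent a)) //= big1 ?addr0 => [|v v_neq].
  by rewrite kary_childE eqxx andbT.
by rewrite kary_childE (negPf v_neq) andbF mul0r.
Qed.

(** The ancestors of [a] are those of its parent together with [a] itself, so row [a] of the product
    retains only the entry at [a]. *)
Lemma incidence_mul_prefix : B *m Q = 1%:M.
Proof.
apply/matrixP => i j; rewrite !mxE.
set a := vert i; set w := vert j.
transitivity (\sum_v ((v == a)%:R - (kary_child v a)%:R) * (prefix w v)%:R : R).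
  rewrite [RHS](reindex vert) /=; last exact/onW_bij/old_vertex_bij.
  by apply: eq_bigr => v _; rewrite !mxE.
under eq_bigr do rewrite mulrBl.
rewrite sumrB sum_kary_child (bigD1 a) //= eqxx mul1r big1 ?addr0; last first.
  by move=> v /negPf ->; rewrite mul0r.
have -> : (i == j) = (a == w) by rewrite (inj_eq (@old_vertex_inj _ _)).
have [-> | a_neq] /= := eqVneq a root.
  by rewrite mul0r subr0 eq_sym -val_eqE /=; case: (bseqval w).
rewrite mul1r (prefix_kary_parent w a_neq) eq_sym.
have [aw | _] /= := eqVneq a w; last by rewrite subrr.
rewrite -aw (negPf (kary_child_prefix _)) ?subr0 //.
by rewrite kary_childE a_neq eqxx.
Qed.

Lemma kary_adjE (u v : V) :
  (kary_adj u v)%:R = (kary_child u v)%:R + (kary_child v u)%:R :> R.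
Proof.
rewrite /kary_adj; case uv: (kary_child u v); last by rewrite add0r.
case vu: (kary_child v u); last by rewrite addr0.
have /negP[] := kary_child_prefix uv.
by case/existsP: vu => a /eqP ->; exact: prefix_rcons.
Qed.

(* The 1 counts the edge to the parent, which is vertex 0 for the root. *)
Lemma kary_degree (u : V) :
  (#|[pred w | kary_adj u w]| + (u == root))%N%:R =
  \sum_w (kary_child u w)%:R + 1 :> R.
Proof.
rewrite natrD -sum1_card natr_sum big_mkcond /=.
rewrite (eq_bigr (fun w => (kary_child u w)%:R + (kary_child w u)%:R * 1))
  => [|w _].
  by rewrite big_split /= sum_kary_child -addrA; case: (u == root);
    rewrite /= ?(mul0r, add0r, mul1r, addr0).
by rewrite mulr1 -kary_adjE inE; case: (kary_adj u w).
Qed.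

(** Distinct vertices share no child, so the child-child products survive only on the diagonal,
    where they count children; the mixed products give the adjacency. *)
Lemma kary_L0_incidence : kary_L0 R k n = B^T *m B.
Proof.
apply/matrixP => i j; rewrite reduced_laplacian_add_leafE kary_degree !mxE.
set u := vert i; set v := vert j.
transitivity (\sum_a ((u == a)%:R - (kary_child u a)%:R)
  * ((v == a)%:R - (kary_child v a)%:R) : R); last first.
  rewrite (reindex vert) /=; last exact/onW_bij/old_vertex_bij.
  by apply: eq_bigr => a _; rewrite !mxE.
have pick (w : V) (F : V -> R) : \sum_a (w == a)%:R * F a = F w.
  rewrite (bigD1 w) //= eqxx mul1r big1 ?addr0 // => a.
  by rewrite eq_sym => /negPf ->; rewrite mul0r.
have child_mul a : (kary_child u a)%:R * (kary_child v a)%:R =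
    (u == v)%:R * (kary_child u a)%:R :> R.
  have [<- | uv] := eqVneq u v; first by case: kary_child; rewrite !mul1r ?mul0r.
  rewrite mul0r !kary_childE; have [ua | _] := eqVneq u (kary_parent a).
    by rewrite -ua (eq_sym v) (negPf uv) andbF mulr0.
  by rewrite andbF mul0r.
under [RHS]eq_bigr => a _.
  rewrite mulrBl [X in _ - X]mulrBr child_mul [X in _ - (X - _)]mulrC.
  over.
rewrite !sumrB !pick -mulr_sumr kary_adjE (eq_sym v) -[_ *+ _]mulr_natl.
ring.
Qed.

Lemma kary_L0_common_ancestors :
  kary_L0 R k n *m map_mx (fun a : nat => a%:R) (common_ancestors k n) = 1%:M.
Proof.
have -> : map_mx (fun a : nat => a%:R) (common_ancestors k n) = Q *m Q^T.
  apply/matrixP => i j; rewrite !mxE natr_sum.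
  rewrite (reindex vert) /=; last exact/onW_bij/old_vertex_bij.
  by apply: eq_bigr => w _; rewrite natrM !mxE.
rewrite kary_L0_incidence -mulmxA (mulmxA B) incidence_mul_prefix mul1mx.
(* What remains is the transpose of [Q *m B], and for square matrices [B *m Q = 1] gives
   [Q *m B = 1]. *)
by rewrite -trmx_mul (mulmx1C incidence_mul_prefix) trmx1.
Qed.

Lemma kary_L0_int : kary_L0 R k n \is a mxOver Num.int.
Proof.
apply/mxOverP => i j; rewrite reduced_laplacian_add_leafE.
by rewrite -mulr_natr -natrM; apply: rpredB; exact: natr_int.
Qed.

End KaryInverse.

Theorem theorem3p4 (R : realType) (k n : nat)
    (k_ge1 : (1 <= k)%N) (n_ge1 : (1 <= n)%N) :
  let C := cone (kary_L0 R k n) in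
  [/\ has_int_point_series C,
      int_point_series C =
        1 / \prod_(1 <= j < n.+1)
              (1 - series_q ^+ exponent1 k n j) ^+ (k ^ (j - 1))%N,
      forall j : nat, (1 <= j <= n)%N -> 0 <= exponent2 k n j
    & int_point_series C =
        1 / \prod_(1 <= j < n.+1)
              (1 - series_q ^+ `|exponent2 k n j|%N) ^+ (k ^ (j - 1))%N].
Proof.
move=> C.
have c_gt0 j : (0 < \sum_i common_ancestors k n i j)%N.
  by rewrite sum_common_ancestors // exponent1_gt0.
have M_int := kary_L0_int R k n.
have MG := kary_L0_common_ancestors R k n.
have CE : int_point_series C = 1 / \prod_(1 <= j < n.+1)
    (1 - series_q ^+ exponent1 k n j) ^+ (k ^ (j - 1))%N.
  rewrite (int_point_series_unimodular M_int MG c_gt0); congr (1 / _).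
  under eq_bigr do rewrite sum_common_ancestors //.
  (* Shifting [j] to the depth [j - 1] and writing powers as iterated products matches the grouping
     by levels. *)
  rewrite big_add1 /=; under [RHS]eq_bigr do rewrite subn1 /= -iter_mulr_1.
  rewrite -(big_kary_level _ k (fun m => 1 - series_q ^+ exponent1 k n m.+1)) //.
  rewrite [RHS](reindex (old_vertex (kary_root k n))) //=.
  exact/onW_bij/old_vertex_bij.
split=> // [|j j_in|].
- exact: has_int_point_series_unimodular M_int MG c_gt0.
- by rewrite exponent2E.
- by rewrite CE; congr (1 / _); apply: eq_big_nat => j j_in; rewrite exponent2E.
Qed.
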